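(* Let $\alpha\ge 1$ be an integer and let $G$ be a graph with independence number $\alpha(G)=\alpha$ whose edges are colored with two colors. Then $V(G)$ can be covered by the vertex sets of $\lfloor 3\alpha/2\rfloor$ monochromatic connected subgraphs of $G$, each of diameter at most $4$. In other words, $g(2,4,\alpha)\le \lfloor 3\alpha/2\rfloor$.
   Context: Graphs are finite and simple. A monochromatic subgraph is a subgraph (not necessarily induced) all of whose edges have the same color; a single vertex counts as a monochromatic subgraph. Different subgraphs in a cover may have different colors, and need not be disjoint or distinct. The diameter of a graph $H$ is the smallest integer $d$ with $d_H(u,v)\le d$ for all $u,v\in V(H)$, where distances are measured in $H$ itself ($\infty$ if there is no path); a one-vertex graph has diameter $0$. $g(r,d,\alpha)$ denotes the minimum $k$ such that for every graph $G$ with $\alpha(G)=\alpha$ and every coloring of the edges of $G$ with $r$ colors, $V(G)$ can be covered by the vertex sets of $k$ monochromatic subgraphs of diameter at most $d$. *)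

(* Defs.v *)
From mathcomp Require Import all_boot.
Set Implicit Arguments.
Unset Strict Implicit.
Unset Printing Implicit Defensive.

(* A nonempty finite simple graph whose vertices are taken from an ambient
   finite type T; an edge is a two-element set of vertices.  Having an explicit
   vertex set lets a graph and its subgraphs be objects of the same type. *)
Record graph (T : finType) := Graph {
  verts : {set T};
  edges : {set {set T}};
  verts_neq0 : verts != set0;
  edgesP : forall A, A \in edges -> (A \subset verts) /\ #|A| = 2
}.

Section Graphs.
Variable T : finType.
Implicit Types (G H : graph T) (S : {set T}) (x y : T).

Definition adj G : rel T := fun x y => [set x; y] \in edges G.

Definition subgraph H G : Prop :=
  verts H \subset verts G /\ edges H \subset edges G.

Definition independent G S : bool :=
  (S \subset verts G) && [forall x in S, forall y in S, ~~ adj G x y].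

Definition independence_number G : nat :=
  \max_(S : {set T} | independent G S) #|S|.

(* In ssreflect a path x :: p has size p edges. *)
Definition walk_of_length G x y (n : nat) : Prop :=
  exists p : seq T, [/\ path (adj G) x p, last x p = y & size p = n].

Definition connected_graph G : Prop :=
  {in verts G &, forall x y, exists n, walk_of_length G x y n}.

(* No n satisfies is_dist G x y n when the distance is infinite. *)
Definition is_dist G x y (n : nat) : Prop :=
  walk_of_length G x y n /\ forall m, walk_of_length G x y m -> n <= m.

Definition dists_le G (d : nat) : Prop :=
  {in verts G &, forall x y, exists2 n, is_dist G x y n & n <= d}.

Definition is_diameter G (d : nat) : Prop :=
  dists_le G d /\ forall d', dists_le G d' -> d <= d'.

Definition diameter_le G (d : nat) : Prop :=
  exists2 d', is_diameter G d' & d' <= d.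

(* A colouring is a function on all sets of vertices, of which only the values
   on edges are ever used. *)
Definition monochromatic (r : nat) (c : {set T} -> 'I_r) H : Prop :=
  {in edges H &, forall A B, c A = c B}.

Definition covers (k : nat) (F : 'I_k -> graph T) G : Prop :=
  \bigcup_(i < k) verts (F i) = verts G.

End Graphs.

Definition g_bound (r d alpha k : nat) : Prop :=
  forall (T : finType) (G : graph T) (c : {set T} -> 'I_r),
    independence_number G = alpha ->
    exists F : 'I_k -> graph T,
      (forall i, [/\ subgraph (F i) G, monochromatic c (F i)
                   & diameter_le (F i) d])
      /\ covers F G.

(* k = g(r, d, alpha), for r > 0. *)
Definition is_g (r d alpha k : nat) : Prop :=
  g_bound r d alpha k /\ forall k', g_bound r d alpha k' -> k <= k'.

(* Main.v *)
(** All covering subgraphs are monochromatic balls of radius 2, by induction on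
    the independence number. If u and v are nonadjacent and three balls cover
    N[u] and N[v], delete both neighbourhoods: the independence number drops by
    at least 2. This happens when u and v have a common neighbour w in colour c
    (take the c-ball at w and the balls at u and v in the other colour), and also
    when they are joined by a path u x y v in colour c (take the c-ball at x
    instead). Otherwise, by induction along a path, the ends of every
    monochromatic path are adjacent, so each monochromatic component is a clique
    of G, which lies in one of the two balls at any of its vertices. Viewing each
    vertex as an edge from its red component to its blue component, independent
    sets are matchings, and König's theorem covers G by alpha components. *)
Require Import Defs.
From mathcomp Require Import all_boot.
From mathcomp Require Import zify.
From Stdlib Require Import Classical.

Set Implicit Arguments.
Unset Strict Implicit.
Unset Printing Implicit Defensive.

(** Serves for cover sizes, distances, diameters and [is_g]: these are minima of [Prop]-valued
    predicates, so excluded middle replaces a decision procedure. *)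
Lemma least_nat (P : nat -> Prop) k :
  P k -> exists2 m, P m /\ (forall j, P j -> m <= j) & m <= k.
Proof.
elim/ltn_ind: k => k IH Pk.
have [[j [Pj ltjk]]|no_less] := classic (exists j, P j /\ j < k).
  by have [m Pm le_mj] := IH j ltjk Pj; exists m; rewrite // (leq_trans le_mj) 1?ltnW.
exists k => //; split=> // j Pj.
by rewrite leqNgt; apply/negP=> ltjk; apply: no_less; exists j.
Qed.

(** * König's theorem for bipartite multigraphs *)

Section Konig.
Variables T A B : finType.

(** A vertex cover of the bipartite multigraph with edge set [V]. *)
Definition label_cover (f : T -> A) (g : T -> B) (V : {set T})
    (P : {set A}) (Q : {set B}) :=
  {in V, forall v, (f v \in P) || (g v \in Q)}.

(* Of the covers (P1 :&: P2, Q1 :|: Q2) and (f x |: (P1 :|: P2), Q1 :&: Q2), whose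
   total size is at most #|P1| + #|Q1| + #|P2| + #|Q2| + 1, one has size < k. *)
Lemma label_cover_uncross f g (V : {set T}) x y P1 Q1 P2 Q2 k :
    x \in V -> y \in V -> x != y -> f x = f y ->
    label_cover f g (V :\ x) P1 Q1 -> label_cover f g (V :\ y) P2 Q2 ->
    #|P1| + #|Q1| < k -> #|P2| + #|Q2| < k ->
  exists P Q, label_cover f g V P Q /\ #|P| + #|Q| < k.
Proof.
move=> Vx Vy neq_xy fxy cov1 cov2 lt1 lt2.
(* Either one of the given covers already handles its deleted edge, or the shared label [f x = f y]
   lies in neither [P1] nor [P2], and each cover must meet the other's deleted edge on the [g]
   side. *)
have [x1|] := boolP ((f x \in P1) || (g x \in Q1)).
  exists P1, Q1; split=> // v Vv; have [->//|neq_vx] := eqVneq v x.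
  by apply: cov1; rewrite !inE neq_vx.
have [y2|] := boolP ((f y \in P2) || (g y \in Q2)).
  exists P2, Q2; split=> // v Vv; have [->//|neq_vy] := eqVneq v y.
  by apply: cov2; rewrite !inE neq_vy.
rewrite !negb_or => /andP[fyP2 _] /andP[fxP1 _].
have gxQ2 : g x \in Q2.
  by have := cov2 x; rewrite !inE neq_xy Vx fxy (negPf fyP2) => /(_ isT).
have gyQ1 : g y \in Q1.
  by have := cov1 y; rewrite !inE eq_sym neq_xy Vy -fxy (negPf fxP1) => /(_ isT).
have covI : label_cover f g V (P1 :&: P2) (Q1 :|: Q2).
  move=> v Vv; rewrite !inE.
  have [->|neq_vx] := eqVneq v x; first by rewrite gxQ2 !orbT.
  have [->|neq_vy] := eqVneq v y; first by rewrite gyQ1 !orbT.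
  have := cov1 v; have := cov2 v; rewrite !inE neq_vx neq_vy Vv => /(_ isT) + /(_ isT).
  by do 4![case: (_ \in _)].
have covU : label_cover f g V (f x |: (P1 :|: P2)) (Q1 :&: Q2).
  move=> v Vv; rewrite !inE.
  have [->|neq_vx] := eqVneq v x; first by rewrite eqxx.
  have [->|neq_vy] := eqVneq v y; first by rewrite fxy eqxx.
  have := cov1 v; have := cov2 v; rewrite !inE neq_vx neq_vy Vv => /(_ isT) + /(_ isT).
  by do 4![case: (_ \in _)]; rewrite ?orbT.
have := cardsUI P1 P2; have := cardsUI Q1 Q2.
have := cardsU1 (f x) (P1 :|: P2) => cardU eqQ eqP.
have [ltI|leI] := ltnP (#|P1 :&: P2| + #|Q1 :|: Q2|) k.
  by exists (P1 :&: P2), (Q1 :|: Q2).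
exists (f x |: (P1 :|: P2)), (Q1 :&: Q2); split=> //.
by move: cardU; case: (_ \notin _) => /=; lia.
Qed.

End Konig.

(* [x] is the edge joining the label [f x] to the label [g x] of a bipartite
   multigraph. *)
Theorem konig (T A B : finType) (f : T -> A) (g : T -> B) (V : {set T}) :
  exists (S : {set T}) (P : {set A}) (Q : {set B}),
    [/\ S \subset V, {in S &, injective f}, {in S &, injective g},
        label_cover f g V P Q & #|P| + #|Q| <= #|S|].
Proof.
move: {2}#|V| (leqnn #|V|) => n; elim: n V => [|n IH] V leVn.
  exists set0, set0, set0; split; rewrite ?sub0set ?cards0 //; try by move=> ?; rewrite inE.
  by move: leVn; rewrite leqn0 cards_eq0 => /eqP-> v; rewrite inE.
pose Pk k := exists P Q, label_cover f g V P Q /\ #|P| + #|Q| <= k.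
have [k [[P [Q [covPQ lePQ]]] min_k] _] : exists2 m, Pk m /\ (forall j, Pk j -> m <= j) & m <= #|V|.
  apply: least_nat; exists (f @: V), set0; split; last by rewrite cards0 addn0 leq_imset_card.
  by move=> v Vv; rewrite imset_f.
have no_less P' Q' : label_cover f g V P' Q' -> #|P'| + #|Q'| < k -> False.
  by move=> cov; rewrite ltnNge min_k //; exists P', Q'.
(* Without a matching of size [k], induction makes every edge deletion lower the cover number below
   [k]. Uncrossing then forbids shared labels, so [V] itself is a matching, and [f @: V] covers it,
   whence [k <= #|V|]. *)
have [done|crit] := classic (exists S : {set T},
    [/\ S \subset V, {in S &, injective f}, {in S &, injective g} & k <= #|S|]).
  by have [S [? ? ? ?]] := done; exists S, P, Q; split=> //; apply: leq_trans lePQ _.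
have cov_minus v : v \in V -> exists P' Q', label_cover f g (V :\ v) P' Q' /\ #|P'| + #|Q'| < k.
  move=> Vv; have [|S [P' [Q' [sSV fI gI cov le_S]]]] := IH (V :\ v).
    by move: leVn; rewrite (cardsD1 v) Vv.
  exists P', Q'; split=> //; apply: leq_ltn_trans le_S _; rewrite ltnNge.
  apply/negP=> le_k; apply: crit; exists S; split=> //.
  exact: subset_trans sSV (subD1set _ _).
case: crit; exists V; split=> // [x y Vx Vy eq_xy|x y Vx Vy eq_xy|].
- apply/eqP; apply/negPn/negP=> neq_xy.
  have [P1 [Q1 [cov1 lt1]]] := cov_minus x Vx.
  have [P2 [Q2 [cov2 lt2]]] := cov_minus y Vy.
  have [P' [Q' [cov']]] := label_cover_uncross Vx Vy neq_xy eq_xy cov1 cov2 lt1 lt2.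
  exact: no_less.
- apply/eqP; apply/negPn/negP=> neq_xy.
  have [P1 [Q1 [cov1 lt1]]] := cov_minus x Vx.
  have [P2 [Q2 [cov2 lt2]]] := cov_minus y Vy.
  rewrite addnC in lt1; rewrite addnC in lt2.
  have flip W P' Q' : label_cover f g W P' Q' -> label_cover g f W Q' P'.
    by move=> cov v Wv; rewrite orbC cov.
  have [Q' [P' [cov' lt']]] := label_cover_uncross Vx Vy neq_xy eq_xy
    (flip _ _ _ cov1) (flip _ _ _ cov2) lt1 lt2.
  apply: (no_less P' Q'); last by rewrite addnC.
  by move=> v Vv; rewrite orbC cov'.
- apply: min_k; exists (f @: V), set0; split; last by rewrite cards0 addn0 leq_imset_card.
  by move=> v Vv; rewrite imset_f.
Qed.

(** * Covering two-coloured graphs by monochromatic balls *)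

Section Balls.
Variable T : finType.
Implicit Types (r : rel T) (e : bool -> rel T) (W S : {set T}) (q : bool * T).

Definition ball2 r w : {set T} :=
  [set x | [|| x == w, r w x | [exists y, r w y && r y x]]].

Lemma ball2_center r w : w \in ball2 r w.
Proof. by rewrite inE eqxx. Qed.

Lemma ball2_1 r w x : r w x -> x \in ball2 r w.
Proof. by rewrite inE => ->; rewrite orbT. Qed.

Lemma ball2_2 r w y x : r w y -> r y x -> x \in ball2 r w.
Proof.
by move=> rwy ryx; rewrite inE; apply/or3P/Or33/existsP; exists y; rewrite rwy.
Qed.

Lemma ball2_sub r1 r2 w : subrel r1 r2 -> ball2 r1 w \subset ball2 r2 w.
Proof.
move=> sub12; apply/subsetP=> x; rewrite inE.
case/or3P=> [/eqP->|/sub12/ball2_1 //|/existsP[y /andP[/sub12 wy /sub12 yx]]].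
  exact: ball2_center.
exact: ball2_2 wy yx.
Qed.

Definition close e : rel T := fun x y => [|| x == y, e true x y | e false x y].

Lemma closeP e x y :
  reflect (x = y \/ exists c, e c x y) (close e x y).
Proof.
apply: (iffP or3P) => [[/eqP->|exy|exy]|[->|[[] exy]]].
- by left.
- by right; exists true.
- by right; exists false.
- exact: Or31.
- exact: Or32.
- exact: Or33.
Qed.

Lemma edge_close e c x y : e c x y -> close e x y.
Proof. by move=> exy; apply/closeP; right; exists c. Qed.

(** Independent sets of the union of both colour classes. *)
Definition close_free e S := {in S &, forall x y, close e x y -> x = y}.

Definition cball e q := ball2 (e q.1) q.2.

Definition cliquish e := forall c x y, connect (e c) x y -> close e x y.

Definition reducible e W := exists u v q1 q2 q3,
  [/\ [/\ u \in W, v \in W & ~~ close e u v],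
      [/\ q1.2 \in W, q2.2 \in W & q3.2 \in W]
    & forall z, close e u z || close e v z ->
        [|| z \in cball e q1, z \in cball e q2 | z \in cball e q3]].

Section Symmetric.
Variables (e : bool -> rel T) (W : {set T}).
Hypothesis e_sym : forall c, symmetric (e c).
Hypothesis e_supp : forall c x y, e c x y -> x \in W.

Lemma close_sym : symmetric (close e).
Proof. by move=> x y; rewrite /close eq_sym !(e_sym _ x). Qed.

Lemma e_supp2 c x y : e c x y -> y \in W.
Proof. by rewrite e_sym => /e_supp. Qed.

Lemma neg_color c d : d != c -> d = ~~ c.
Proof. by case: c d => [] []. Qed.

(** * Monochromatic paths when no reducible pair exists *)

Section Irreducible.
Hypothesis irred : ~ reducible e W.

(** Otherwise [u] and [v] form a reducible pair: their [c]-neighbours are within two [c]-steps of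
    [w], the others one step of colour [~~ c] from [u] or [v]. *)
Lemma close_path2 c u w v : e c u w -> e c w v -> close e u v.
Proof.
move=> uw wv; apply/negPn/negP=> Nuv; apply: irred.
have [Wu Wv] := (e_supp uw, e_supp2 wv).
have wu : e c w u by rewrite e_sym.
exists u, v, (c, w), (~~ c, u), (~~ c, v); split=> //; first by rewrite (e_supp wu).
move=> z; rewrite /cball /=; case/orP=> /closeP[<-|[d dz]].
- by rewrite ball2_center orbT.
- have [eq_dc|/neg_color eq_d] := eqVneq d c; rewrite ?eq_d ?eq_dc in dz.
    by rewrite (ball2_2 wu dz).
  by rewrite (ball2_1 dz) orbT.
- by rewrite ball2_center !orbT.
- have [eq_dc|/neg_color eq_d] := eqVneq d c; rewrite ?eq_d ?eq_dc in dz.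
    by rewrite (ball2_2 wv dz).
  by rewrite (ball2_1 dz) !orbT.
Qed.

(** If [u], [v] are nonadjacent, the two-step case forces [u y] to be an edge of colour [~~ c]. For
    a [c]-neighbour [z] of [v], it also makes [y] and [z] equal or adjacent; so [z] is reached
    through [y] from [x] in colour [c] or from [u] in colour [~~ c]. *)
Lemma close_path3 c u x y v : e c u x -> e c x y -> e c y v -> close e u v.
Proof.
move=> ux xy yv; apply/negPn/negP=> Nuv; apply: irred.
have [Wu Wv] := (e_supp ux, e_supp2 yv).
have xu : e c x u by rewrite e_sym.
have vy : e c v y by rewrite e_sym.
have Nuy : e (~~ c) u y.
  have /closeP[eq_uy|[d uy]] := close_path2 ux xy.
    by rewrite eq_uy (edge_close yv) in Nuv.
  have [eq_dc|/neg_color<- //] := eqVneq d c.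
  by rewrite eq_dc in uy; rewrite (close_path2 uy yv) in Nuv.
exists u, v, (c, x), (~~ c, u), (~~ c, v); split=> //; first by rewrite (e_supp xy).
move=> z; rewrite /cball /=; case/orP=> /closeP[<-|[d dz]].
- by rewrite ball2_center orbT.
- have [eq_dc|/neg_color eq_d] := eqVneq d c; rewrite ?eq_d ?eq_dc in dz.
    by rewrite (ball2_2 xu dz).
  by rewrite (ball2_1 dz) orbT.
- by rewrite ball2_center !orbT.
have [eq_dc|/neg_color eq_d] := eqVneq d c; rewrite ?eq_d ?eq_dc in dz; last first.
  by rewrite (ball2_1 dz) !orbT.
have /closeP[<-|[d' yz]] := close_path2 yv dz; first by rewrite (ball2_1 xy).
have [eq_dc'|/neg_color eq_d'] := eqVneq d' c; rewrite ?eq_d' ?eq_dc' in yz.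
  by rewrite (ball2_2 xy yz).
by rewrite (ball2_2 Nuy yz) orbT.
Qed.

Lemma irreducible_cliquish : cliquish e.
Proof.
move=> c x _ /connectP[p xp ->].
move: {2}(size p) (leqnn (size p)) => n.
elim: n x p xp => [|n IH] x [|a [|b q]] //=; try by rewrite /close eqxx.
  by rewrite andbT => /edge_close.
case/and3P=> xa ab bq; rewrite ltnS => leq.
have bz : close e b (last b q) by apply: IH => //; apply: ltnW.
(* Let [z] be the end of the path. An edge [x b] of colour [c] shortens the path. Otherwise an edge
   [b z] of colour [c] gives the three-step path [x a b z], and one of the other colour gives the
   two-step path [x b z]. *)
have /closeP[eq_xb|[d xb]] := close_path2 xa ab; first by rewrite eq_xb.
have [eq_dc|/neg_color eq_d] := eqVneq d c.
  by apply: (IH x (b :: q)); rewrite //= bq -eq_dc xb.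
have /closeP[<-|[d' bz']] := bz; first exact: edge_close xb.
have [eq_dc'|/neg_color eq_d'] := eqVneq d' c.
  by rewrite eq_dc' in bz'; apply: close_path3 xa ab bz'.
by apply: close_path2 xb _; rewrite eq_d -eq_d'.
Qed.

End Irreducible.

(** If [v] in the component escapes the [true]-ball at [a], then [a v] is [false]. Any [w] joined to
    [a] by a [true] edge is [v] or has a [false] edge to [v], hence is within two [false] steps of
    [a]. The colour [d] may differ from [c]. *)
Lemma clique_ball c a : cliquish e ->
  exists d, {subset connect (e c) a <= cball e (d, a)}.
Proof.
move=> clq; have [sub|] := boolP (connect (e c) a \subset cball e (true, a)).
  by exists true; apply/subsetP.
case/subsetPn=> v av Nav; exists false => w aw; rewrite /cball /=.
have {Nav} [Neq Nav Nwv] : [/\ v != a, ~~ e true a v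
    & forall w, e true a w -> ~~ e true w v].
  split=> [||x ax]; apply: contra Nav; first by move/eqP->; apply: ball2_center.
    exact: ball2_1.
  exact: ball2_2 ax.
have av' : e false a v.
  have /closeP[eq_av|[[] //]] := clq c a v av; first by rewrite eq_av eqxx in Neq.
  by move=> av'; rewrite av' in Nav.
have /closeP[<-|[[] aw']] := clq c a w aw; [exact: ball2_center| |exact: ball2_1].
have vw : connect (e c) v w.
  by apply: connect_trans aw; rewrite (sym_connect_sym (e_sym c)).
have /closeP[<-|[[] vw']] := clq c v w vw; first exact: ball2_1.
  by have := Nwv w aw'; rewrite e_sym vw'.
exact: ball2_2 av' vw'.
Qed.

Lemma cliquish_cover n : cliquish e ->
    (forall S, S \subset W -> close_free e S -> #|S| <= n) ->
  exists s : seq (bool * T), [/\ size s <= n, all (fun q => q.2 \in W) s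
    & {in W, forall x, has (fun q => x \in cball e q) s}].
Proof.
move=> clq indep.
(* A vertex is labelled by the roots of its two monochromatic components. Adjacent vertices share a
   label, so a matching is independent. *)
have [S [P [Q [sSW fI gI cov le_PQ]]]] := konig (root (e true)) (root (e false)) W.
have le_Sn : #|S| <= n.
  apply: indep sSW _ => x y Sx Sy /closeP[//|[[] xy]]; [apply: fI|apply: gI];
  by rewrite //; apply/(rootP (sym_connect_sym (e_sym _)))/connect1.
have ballP c a : {d | {subset connect (e c) a <= cball e (d, a)}}.
  have ex : exists d, connect (e c) a \subset cball e (d, a).
    by have [d sub] := clique_ball c a clq; exists d; apply/subsetP.
  by have [d /subsetP sub] := sigW ex; exists d.
pose bl c a := (sval (ballP c a), a).
have blP c x : x \in W -> root (e c) x \in W /\ x \in cball e (bl c (root (e c) x)).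
  move=> Wx; have csym := sym_connect_sym (e_sym c).
  have rx : connect (e c) (root (e c) x) x by rewrite csym connect_root.
  split; last exact: (svalP (ballP c _)).
  by case/connectP: rx => [[|y p] /= rx eq_x]; [rewrite -eq_x|case/andP: rx => /e_supp].
(* Intersecting with [W] keeps the centres in [W] and loses nothing, since roots of vertices of [W]
   lie in [W]. *)
exists ([seq bl true a | a in P :&: W] ++ [seq bl false a | a in Q :&: W]); split.
- rewrite size_cat !size_image; apply: leq_trans le_Sn; apply: leq_trans le_PQ.
  by apply: leq_add; apply/subset_leq_card/subsetIl.
- by rewrite all_cat; apply/andP; split; apply/allP=> _ /imageP[a + ->] /=;
    rewrite inE => /andP[].
move=> x Wx; rewrite has_cat; apply/orP.
have [/orP[] mem] := cov x Wx; [left|right]; apply/hasP.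
  exists (bl true (root (e true) x)); last by have [] := blP true x Wx.
  by apply: image_f; rewrite inE mem; have [] := blP true x Wx.
exists (bl false (root (e false) x)); last by have [] := blP false x Wx.
by apply: image_f; rewrite inE mem; have [] := blP false x Wx.
Qed.

End Symmetric.

(** Relations on a set [W] are used because deleting neighbourhoods may leave no vertex, which
    [graph] excludes; [n] is only an upper bound because the independence number may drop by more
    than 2. *)
Theorem ball_cover n e W : (forall c, symmetric (e c)) ->
    (forall c x y, e c x y -> x \in W) ->
    (forall S, S \subset W -> close_free e S -> #|S| <= n) ->
  exists s : seq (bool * T), [/\ size s <= (3 * n) %/ 2,
      all (fun q => q.2 \in W) s
    & {in W, forall x, has (fun q => x \in cball e q) s}].
Proof.
elim/ltn_ind: n e W => n IH e W e_sym e_supp indep.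
have [|irr] := classic (reducible e W); last first.
  have [s [les Ws cov]] :=
    cliquish_cover e_sym e_supp (irreducible_cliquish e_sym e_supp irr) indep.
  by exists s; split=> //; lia.
case=> u [v [q1 [q2 [q3 [[Wu Wv Nuv] [Wq1 Wq2 Wq3] red]]]]].
pose W' := [set x in W | ~~ (close e u x || close e v x)].
have W'W : W' \subset W by apply/subsetP=> x; rewrite inE => /andP[].
pose e' c := [rel x y | [&& x \in W', y \in W' & e c x y]].
have e'e c : subrel (e' c) (e c) by move=> x y /and3P[].
(* Adding [u] and [v] to an independent set of the remainder keeps it independent. *)
have indep' S : S \subset W' -> close_free e' S -> #|S|.+2 <= n.
  move=> /subsetP sSW' freeS.
  have NS x : x \in S -> [/\ x \in W, ~~ close e u x & ~~ close e v x].
    by move/sSW'; rewrite inE negb_or => /and3P.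
  have NuS : u \notin S by apply/negP=> /NS[_]; rewrite /close eqxx.
  have NvS : v \notin S by apply/negP=> /NS[_ _]; rewrite /close eqxx.
  have neq_uv : u != v by apply: contraNneq Nuv => ->; rewrite /close eqxx.
  have := indep (u |: (v |: S)).
  rewrite !cardsU1 !inE negb_or neq_uv NuS NvS; apply.
    by rewrite !subUset !sub1set Wu Wv (subset_trans _ W'W) //; apply/subsetP.
  have csym := close_sym e_sym.
  move=> x y; rewrite !inE => /or3P[/eqP->|/eqP->|Sx] /or3P[/eqP->|/eqP->|Sy] //.
  - by rewrite (negPf Nuv).
  - by have [_ /negPf->] := NS y Sy.
  - by rewrite csym (negPf Nuv).
  - by have [_ _ /negPf->] := NS y Sy.
  - by have [_ /negPf] := NS x Sx; rewrite csym => ->.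
  - by have [_ _ /negPf] := NS x Sx; rewrite csym => ->.
  case/closeP=> // [[c xy]]; apply: freeS => //; apply: (@edge_close e' c).
  by rewrite /= !sSW'.
(* Ensures that [n - 2] is not truncated, so that three balls plus [(3 * (n - 2)) %/ 2] give exactly
   [(3 * n) %/ 2]. *)
have n_ge2 : 1 < n.
  by have := indep' set0; rewrite cards0 sub0set; apply=> // x y; rewrite inE.
have [||c x y /and3P[]|S sSW' freeS|s [les Ws cov]] // := IH (n - 2) _ e' W'.
- by lia.
- by move=> c x y; rewrite /= e_sym; do 2![case: (_ \in _)].
- by have := indep' S sSW' freeS; lia.
exists [:: q1, q2, q3 & s]; split=> [/=||x Wx]; first by lia.
  by rewrite /= Wq1 Wq2 Wq3; apply: sub_all Ws => q; apply: (subsetP W'W).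
have [/red|Nx] := boolP (close e u x || close e v x).
  by rewrite /= => /or3P[]->; rewrite ?orbT.
have W'x : x \in W' by rewrite inE Wx.
rewrite /= !orbA; apply/orP; right; apply: sub_has (cov x W'x) => q.
exact/subsetP/ball2_sub/e'e.
Qed.

End Balls.

(** * From balls to subgraphs of bounded diameter *)

Lemma dists_le_diameter (T : finType) (H : graph T) d :
    {in verts H &, forall x y, exists2 n, walk_of_length H x y n & n <= d} ->
  connected_graph H /\ diameter_le H d.
Proof.
move=> walks; split=> [x y Hx Hy|]; first by have [n] := walks x y Hx Hy; exists n.
have dists : dists_le H d.
  move=> x y Hx Hy; have [n xyn len] := walks x y Hx Hy.
  by have [m dist_m le_mn] := least_nat xyn; exists m; last exact: leq_trans len.
by have [m diam_m le_md] := least_nat dists; exists m.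
Qed.

Section BallGraph.
Variables (T : finType) (G : graph T) (c : {set T} -> 'I_2).

Definition color_adj (b : bool) : rel T :=
  fun x y => adj G x y && ((c [set x; y] == ord0) == b).

Lemma color_adj_sym b : symmetric (color_adj b).
Proof. by move=> x y; rewrite /color_adj /adj setUC. Qed.

Lemma adj_verts x y : adj G x y -> x \in verts G.
Proof. by case/edgesP=> /subsetP sub _; apply: sub; rewrite !inE eqxx. Qed.

Lemma adj_neq x y : adj G x y -> x != y.
Proof. by case/edgesP=> _; rewrite cards2; case: eqP. Qed.

Definition ball_verts q := cball color_adj q.

Definition ball_edges (q : bool * T) :=
  [set A in edges G | (A \subset ball_verts q) && ((c A == ord0) == q.1)].

Lemma ball_verts_neq0 q : ball_verts q != set0.
Proof. by apply/set0Pn; exists q.2; apply: ball2_center. Qed.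

Lemma ball_edgesP q A : A \in ball_edges q -> (A \subset ball_verts q) /\ #|A| = 2.
Proof. by rewrite inE => /and3P[/edgesP[_ cardA] -> _]. Qed.

Definition ball_graph q := Graph (ball_verts_neq0 q) (@ball_edgesP q).

Lemma ball_graph_adj q x y : x \in ball_verts q -> y \in ball_verts q ->
  color_adj q.1 x y -> adj (ball_graph q) x y.
Proof.
by move=> Bx By /andP[xy cxy]; rewrite /adj inE [_ \in edges G]xy cxy subUset !sub1set Bx By.
Qed.

Lemma ball_graph_radius q x : x \in ball_verts q -> exists p,
  [/\ path (adj (ball_graph q)) q.2 p, last q.2 p = x & size p <= 2].
Proof.
move=> Bx; have Bq : q.2 \in ball_verts q by apply: ball2_center.
move: (Bx); rewrite inE => /or3P[/eqP->|qx|/existsP[y /andP[qy yx]]].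
- by exists [::].
- by exists [:: x]; split; rewrite //= ball_graph_adj.
(* The middle vertex also lies in the ball, so the path survives in the ball graph itself. *)
have By : y \in ball_verts q by apply: ball2_1.
by exists [:: y; x]; split; rewrite //= !ball_graph_adj.
Qed.

Lemma ball_graphP q : q.2 \in verts G ->
  [/\ subgraph (ball_graph q) G, monochromatic c (ball_graph q),
      connected_graph (ball_graph q) & diameter_le (ball_graph q) 4].
Proof.
move=> Gq; have [conn diam] : connected_graph (ball_graph q) /\ diameter_le (ball_graph q) 4.
  apply: dists_le_diameter => x y /ball_graph_radius[p [qp <- lep]].
  case/ball_graph_radius=> p' [qp' <- lep'].
  (* The walk goes back along [p] to the centre, then out along [p']: two radii give 4. *)
  exists (size p + size p'); last by lia.
  have adj_sym : symmetric (adj (ball_graph q)) by move=> a b; rewrite /adj setUC.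
  have last_rev : last (last q.2 p) (rev (belast q.2 p)) = q.2.
    by case: p {qp lep} => //= a p; rewrite rev_cons last_rcons.
  exists (rev (belast q.2 p) ++ p'); split; last by rewrite size_cat size_rev size_belast.
    rewrite cat_path last_rev qp' andbT rev_path.
    by rewrite (eq_path (e' := adj (ball_graph q))) // => a b; apply: adj_sym.
  by rewrite last_cat last_rev.
split=> //.
  split; apply/subsetP; last by move=> A; rewrite inE => /andP[].
  move=> x; rewrite inE => /or3P[/eqP-> //|qx|/existsP[y /andP[_ yx]]].
    by move: qx; rewrite color_adj_sym => /andP[/adj_verts].
  by move: yx; rewrite color_adj_sym => /andP[/adj_verts].
move=> A B; rewrite !inE => /and3P[_ _ /eqP<-] /and3P[_ _ /eqP].
(* With two colours, being [ord0] or not determines the colour. *)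
case: (c A) (c B) => [[|[|//]] ltA] [[|[|//]] ltB] //= _; exact: val_inj.
Qed.

Lemma graph_close_free (S : {set T}) :
  S \subset verts G -> close_free color_adj S -> #|S| <= independence_number G.
Proof.
move=> sSG freeS; apply: (@leq_bigmax_cond _ _ (fun S : {set T} => #|S|)).
rewrite /independent sSG; apply/forall_inP=> x Sx; apply/forall_inP=> y Sy.
apply/negP=> xy; have /eqP[] := adj_neq xy; apply: freeS => //.
apply: (@edge_close _ _ (c [set x; y] == ord0)).
by rewrite /color_adj xy eqxx.
Qed.

End BallGraph.

Theorem theorem2p5 (alpha : nat) (alpha_ge1 : 1 <= alpha) :
  (forall (T : finType) (G : graph T) (c : {set T} -> 'I_2),
     independence_number G = alpha ->
     exists F : 'I_((3 * alpha) %/ 2) -> graph T,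
       (forall i, [/\ subgraph (F i) G, monochromatic c (F i),
                      connected_graph (F i) & diameter_le (F i) 4])
       /\ covers F G)
  /\ (exists2 k, is_g 2 4 alpha k & k <= (3 * alpha) %/ 2).
Proof.
have cover : forall (T : finType) (G : graph T) (c : {set T} -> 'I_2),
     independence_number G = alpha ->
     exists F : 'I_((3 * alpha) %/ 2) -> graph T,
       (forall i, [/\ subgraph (F i) G, monochromatic c (F i),
                      connected_graph (F i) & diameter_le (F i) 4])
       /\ covers F G.
  move=> T G c alphaG; have [x0 Gx0] := set0Pn _ (verts_neq0 G).
  have [||S sSG|s [les Ws cov]] := @ball_cover T alpha (color_adj G c) (verts G).
  - exact: color_adj_sym.
  - by move=> b x y /andP[/adj_verts].
  - by rewrite -alphaG; apply: graph_close_free.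
  (* The list may be shorter than the required number of subgraphs; surplus indices get the ball at
     [x0], a vertex of [G]. *)
  pose q i := nth (true, x0) s i.
  have Gq i : (q i).2 \in verts G.
    have [lt_is|le_si] := ltnP i (size s); last by rewrite /q nth_default.
    by apply: (allP Ws); apply: mem_nth.
  exists (fun i => ball_graph G c (q i)); split=> [i|]; first exact: ball_graphP.
  apply/eqP; rewrite eqEsubset; apply/andP; split.
    by apply/bigcupsP=> i _; have [[]] := ball_graphP c (Gq i).
  apply/subsetP=> x /cov /(has_nthP (true, x0))[i lt_is Bx].
  by apply/bigcupP; exists (Ordinal (leq_trans lt_is les)).
split=> //.
have bound : g_bound 2 4 alpha ((3 * alpha) %/ 2).
  move=> T G c alphaG; have [F [FP covF]] := cover T G c alphaG.
  by exists F; split=> // i; have [] := FP i.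
exact: least_nat bound.
Qed.
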